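(* Let $(\mathfrak{g},\pi,T)$ be an extended Rota-Baxter Lie algebra of weight $(\mu,\lambda)$. If $(\mathfrak{g}[[t]],\mu_t,T_t)$ and $(\mathfrak{g}[[t]],\mu_t',T_t')$ are equivalent $1$-parameter formal deformations of $(\mathfrak{g},\pi,T)$, then their infinitesimals $(\mu_1,T_1)$ and $(\mu_1',T_1')$ are in the same cohomology class in $H^2_{\mathrm{RBA}_{(\mu,\lambda)}}(\mathfrak{g})$.
   Context: $\mathbf{k}$ is a field of characteristic $0$, $\mu,\lambda\in\mathbf{k}$, and $\mathbf{k}$ contains a square root of $\mu^2-4\lambda$. An extended Rota-Baxter Lie algebra of weight $(\mu,\lambda)$ is a Lie algebra $(\mathfrak{g},\pi=[-,-])$ with a linear map $T:\mathfrak{g}\to\mathfrak{g}$ such that $[Ta,Tb]=T([Ta,b]+[a,Tb]+\mu[a,b])+\lambda[a,b]$. A $1$-parameter formal deformation of $(\mathfrak{g},\pi,T)$ is a pair $\mu_t=\sum_{i\ge0}\mu_it^i$, $T_t=\sum_{i\ge0}T_it^i$ with $\mu_i\in\mathrm{Hom}(\wedge^2\mathfrak{g},\mathfrak{g})$, $T_i\in\mathrm{Hom}(\mathfrak{g},\mathfrak{g})$, $\mu_0=\pi$, $T_0=T$, making $\mathfrak{g}[[t]]$ an extended Rota-Baxter Lie algebra of weight $(\mu,\lambda)$ over $\mathbf{k}[[t]]$. Its infinitesimal is $(\mu_1,T_1)$, which is a $2$-cocycle in the complex below. Two deformations $(\mu_t,T_t)$, $(\mu'_t,T'_t)$ are equivalent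 if there is a power series $\psi_t=\sum_{i\ge0}\psi_it^i$ with $\psi_i:\mathfrak{g}\to\mathfrak{g}$ linear, $\psi_0=\mathrm{Id}_{\mathfrak{g}}$, such that $\psi_t\circ\mu'_t=\mu_t\circ(\psi_t\otimes\psi_t)$ and $\psi_t\circ T'_t=T_t\circ\psi_t$. Constants: $B_0=0$, $B_1=1$, $B_{n+1}=\mu B_n-\lambda B_{n-1}$; $A_n=\lambda B_n$ for $n\ge0$, $A_{-1}=-1$. The complex $C^*_{\mathrm{RBA}_{(\mu,\lambda)}}(\mathfrak{g})$: $C^n=\mathrm{Hom}(\wedge^n\mathfrak{g},\mathfrak{g})\oplus\mathrm{Hom}(\wedge^{n-1}\mathfrak{g},\mathfrak{g})$, $n\ge0$, with $\partial_{\mathrm{RBA}_{(\mu,\lambda)}}(f,g)=(\partial_{\mathrm{Lie}}f,\,-\partial_{\mathrm{RB}}g-\delta f)$ and cohomology $H^n_{\mathrm{RBA}_{(\mu,\lambda)}}(\mathfrak{g})$, where for $f\in\mathrm{Hom}(\wedge^n\mathfrak{g},\mathfrak{g})$ $$\partial_{\mathrm{Lie}}(f)(x_1,\dots,x_{n+1})=\sum_{i}(-1)^{i+n}[x_i,f(x_1,\dots,\hat x_i,\dots,x_{n+1})]+\sum_{i<j}(-1)^{i+j+n+1}f([x_i,x_j],x_1,\dots,\hat x_i,\dots,\hat x_j,\dots,x_{n+1}),$$ $$\partial_{\mathrm{RB}}(f)(x_1,\dots,x_{n+1})=\sum_{i}(-1)^{i+n}\big([Tx_i,f(\dots\hat x_i\dots)]-T[x_i,f(\dots\hat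 x_i\dots)]\big)+\sum_{i<j}(-1)^{i+j+n+1}f([Tx_i,x_j]+[x_i,Tx_j]+\mu[x_i,x_j],x_1,\dots,\hat x_i,\dots,\hat x_j,\dots,x_{n+1}),$$ $$\delta(f)(x_1,\dots,x_n)=-\sum_{k=0}^n\sum_{\tau\in\mathrm{Sh}(k,n-k)}\mathrm{sgn}(\tau)A_{n-k-1}f(Tx_{\tau(1)},\dots,Tx_{\tau(k)},x_{\tau(k+1)},\dots,x_{\tau(n)})-\sum_{k=1}^n\sum_{\tau\in\mathrm{Sh}(k-1,n-k+1)}\mathrm{sgn}(\tau)B_{n-k+1}Tf(Tx_{\tau(1)},\dots,Tx_{\tau(k-1)},x_{\tau(k)},\dots,x_{\tau(n)}),$$ $\mathrm{Sh}(p,q)$ denoting $(p,q)$-shuffles. *)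

(* Defs.v *)
From HB Require Import structures.
From mathcomp Require Import all_boot all_order all_algebra all_fingroup.
From mathcomp Require Import all_classical.

Set Implicit Arguments.
Unset Strict Implicit.
Unset Printing Implicit Defensive.

Import GRing.Theory.
Local Open Scope ring_scope.

(* [fps V] is V[[t]]; a series is its sequence of coefficients.  For a ring R,
   [fps R] carries the Cauchy product (not the pointwise ring structure of
   [nat -> R]), and for an R-module V, [fps V] is a module over [fps R]. *)
Definition fps (V : Type) : Type := nat -> V.

HB.instance Definition _ (V : zmodType) :=
  GRing.Zmodule.copy (fps V) (nat -> V).

Lemma fps_addE (V : zmodType) (a b : fps V) n : (a + b) n = a n + b n.
Proof. by []. Qed.

Lemma cauchy_sumA (V : zmodType) (F : nat -> nat -> nat -> V) n :
  \sum_(i < n.+1) \sum_(j < (n - i).+1) F i j (n - i - j)%N =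
  \sum_(i < n.+1) \sum_(j < i.+1) F j (i - j)%N (n - i)%N.
Proof.
have E1 (i : 'I_n.+1) : \sum_(m < n.+1 | (i <= m)%N) F i (m - i)%N (n - m)%N =
    \sum_(j < (n - i).+1) F i j (n - i - j)%N.
  rewrite -(big_mkord (fun m => i <= m)%N (fun m => F i (m - i) (n - m))%N).
  rewrite (@big_cat_nat _ _ _ i) //=; last by rewrite ltnW.
  rewrite [X in X + _]big_nat_cond [X in X + _]big_pred0 ?add0r; last first.
    by move=> m /=; rewrite ltnNge; case: (i <= m)%N.
  rewrite big_nat_cond (eq_bigl (fun m => (i <= m < n.+1)%N && true)); last first.
    by move=> m /=; case: (i <= m)%N; rewrite ?andbF ?andbT.
  rewrite -big_nat_cond -{1}[X in index_iota X _]add0n big_addn big_mkord.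
  rewrite subSn; last by rewrite -ltnS.
  by apply: eq_bigr => j _; rewrite addnK (addnC j) subnDA.
rewrite -(eq_bigr _ (fun i _ => E1 i)) (exchange_big_dep xpredT) //=.
apply: eq_bigr => m _.
rewrite -(big_mkord (fun i => i <= m)%N (fun i => F i (m - i) (n - m))%N).
rewrite -(big_mkord xpredT (fun i => F i (m - i) (n - m))%N).
by rewrite (big_nat_widen 0 m.+1 n.+1).
Qed.

Section SeriesRing.
Variable R : comNzRingType.

Definition fps_one : fps R := fun n => (n == 0%N)%:R.

Definition fps_mul (a b : fps R) : fps R :=
  fun n => \sum_(i < n.+1) a i * b (n - i)%N.

Lemma fps_mulA : associative fps_mul.
Proof.
move=> a b c; apply/funext => n; rewrite /fps_mul.
under eq_bigr do rewrite big_distrr /=.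
rewrite (cauchy_sumA (fun i j l => a i * (b j * c l))).
apply: eq_bigr => i _; rewrite big_distrl /=.
by apply: eq_bigr => j _; rewrite mulrA.
Qed.

Lemma fps_mulC : commutative fps_mul.
Proof.
move=> a b; apply/funext => n; rewrite /fps_mul (reindex_inj rev_ord_inj) /=.
by apply: eq_bigr => i _; rewrite subSS subKn 1?mulrC // -ltnS.
Qed.

Lemma fps_mul1 : left_id fps_one fps_mul.
Proof.
move=> a; apply/funext => n; rewrite /fps_mul /fps_one.
rewrite big_ord_recl /= mul1r subn0 big1 ?addr0 // => i _.
by rewrite mul0r.
Qed.

Lemma fps_mulDl : left_distributive fps_mul +%R.
Proof.
move=> a b c; apply/funext => n; rewrite fps_addE /fps_mul -big_split /=.
by apply: eq_bigr => i _; rewrite fps_addE mulrDl.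
Qed.

Lemma fps_one_neq0 : fps_one != 0.
Proof.
by apply/eqP => /(congr1 (@^~ 0%N)) /eqP; rewrite /fps_one /= oner_eq0.
Qed.

HB.instance Definition _ := GRing.Zmodule_isComNzRing.Build (fps R)
  fps_mulA fps_mulC fps_mul1 fps_mulDl fps_one_neq0.

Definition fpsC (a : R) : fps R := fun n => if n == 0%N then a else 0.

Section SeriesModule.
Variable V : lmodType R.

Definition fps_scale (a : fps R) (v : fps V) : fps V :=
  fun n => \sum_(i < n.+1) a i *: v (n - i)%N.

Lemma fps_scaleA a b v : fps_scale a (fps_scale b v) = fps_scale (a * b) v.
Proof.
apply/funext => n; rewrite /fps_scale.
under eq_bigr do rewrite scaler_sumr.
rewrite (cauchy_sumA (fun i j l => a i *: (b j *: v l))).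
apply: eq_bigr => i _; rewrite scaler_suml.
by apply: eq_bigr => j _; rewrite scalerA.
Qed.

Lemma fps_scale1 : left_id 1 fps_scale.
Proof.
move=> v; apply/funext => n; rewrite /fps_scale big_ord_recl /= scale1r subn0.
by rewrite big1 ?addr0 // => i _; rewrite scale0r.
Qed.

Lemma fps_scaleDr : right_distributive fps_scale +%R.
Proof.
move=> a u v; apply/funext => n; rewrite fps_addE /fps_scale -big_split /=.
by apply: eq_bigr => i _; rewrite fps_addE scalerDr.
Qed.

Lemma fps_scaleDl v : {morph fps_scale^~ v : a b / a + b}.
Proof.
move=> a b; apply/funext => n; rewrite fps_addE /fps_scale -big_split /=.
by apply: eq_bigr => i _; rewrite fps_addE scalerDl.
Qed.

HB.instance Definition _ := GRing.Zmodule_isLmodule.Build (fps R) (fps V)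
  fps_scaleA fps_scale1 fps_scaleDr fps_scaleDl.

End SeriesModule.
End SeriesRing.

Section RotaBaxterLie.
Variables (R : comNzRingType) (V : lmodType R).

Definition alt_bilinear (br : V -> V -> V) : Prop :=
  [/\ forall x, linear (br x), forall y, linear (br^~ y)
    & forall x, br x x = 0].

Definition jacobi (br : V -> V -> V) : Prop :=
  forall x y z, br x (br y z) + br y (br z x) + br z (br x y) = 0.

Definition ext_rota_baxter (br : V -> V -> V) (T : V -> V) (mu lam : R) :=
  forall a b,
    br (T a) (T b) =
    T (br (T a) b + br a (T b) + mu *: br a b) + lam *: br a b.

Definition ext_RB_Lie_algebra (br : V -> V -> V) (T : V -> V) (mu lam : R) :=
  [/\ alt_bilinear br, jacobi br, linear T & ext_rota_baxter br T mu lam].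

End RotaBaxterLie.

Section Deformation.
Variables (k : fieldType) (g : lmodType k).

(* The maps on g[[t]] induced by a power series of linear (resp. bilinear)
   maps on g; they are k[[t]]-linear (resp. bilinear). *)
Definition fps_ext1 (F : nat -> g -> g) (a : fps g) : fps g :=
  fun n => \sum_(i < n.+1) F i (a (n - i)%N).

Definition fps_ext2 (m : nat -> g -> g -> g) (a b : fps g) : fps g :=
  fun n => \sum_(i < n.+1) \sum_(j < (n - i).+1) m i (a j) (b (n - i - j)%N).

Definition formal_deformation (br : g -> g -> g) (T : g -> g) (mu lam : k)
    (mut : nat -> g -> g -> g) (Tt : nat -> g -> g) : Prop :=
  [/\ forall i, alt_bilinear (mut i),
      forall i, linear (Tt i),
      mut 0%N = br,
      Tt 0%N = T
    & ext_RB_Lie_algebra (R := fps k) (V := fps g)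
        (fps_ext2 mut) (fps_ext1 Tt) (fpsC mu) (fpsC lam)].

Definition equivalent_deformations
    (mut : nat -> g -> g -> g) (Tt : nat -> g -> g)
    (mut' : nat -> g -> g -> g) (Tt' : nat -> g -> g) : Prop :=
  exists psi : nat -> g -> g,
    [/\ forall i, linear (psi i),
        psi 0%N = id,
        forall a b : fps g,
          fps_ext1 psi (fps_ext2 mut' a b) =
          fps_ext2 mut (fps_ext1 psi a) (fps_ext1 psi b)
      & forall a : fps g,
          fps_ext1 psi (fps_ext1 Tt' a) = fps_ext1 Tt (fps_ext1 psi a)].

End Deformation.

Section Complex.
Variables (k : fieldType) (g : lmodType k).
Variables (br : g -> g -> g) (T : g -> g) (mu lam : k).

Fixpoint constB (n : nat) : k :=
  match n with
  | 0 => 0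
  | n'.+1 => match n' with
             | 0 => 1
             | n''.+1 => mu * constB n' - lam * constB n''
             end
  end.

(* The index is shifted by one: [constA_pred m] is A_{m-1}. *)
Definition constA_pred (m : nat) : k :=
  if m is m'.+1 then lam * constB m' else - 1.

(* Hom(wedge^n g, g) is the set of those [f : cochain n] with
   [alternating_multilinear f]. *)
Definition cochain (n : nat) : Type := {ffun 'I_n -> g} -> g.

Definition update n (x : {ffun 'I_n -> g}) (i : 'I_n) (u : g) :
  {ffun 'I_n -> g} := [ffun j => if j == i then u else x j].

Definition alternating_multilinear n (f : cochain n) : Prop :=
  (forall x i, linear (fun u => f (update x i u))) /\
  (forall (x : {ffun 'I_n -> g}) i j, i != j -> x i = x j -> f x = 0).

Definition omit n (x : {ffun 'I_n.+1 -> g}) (i : 'I_n.+1) :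
  {ffun 'I_n -> g} := [ffun l => x (lift i l)].

(* (u, x_1, ..., x_{n+1}) with x_i and x_j omitted; for i != j the list below
   has exactly n entries, so the default value of [nth] is never used. *)
Definition omit2_cons n (u : g) (x : {ffun 'I_n.+1 -> g}) (i j : 'I_n.+1) :
  {ffun 'I_n -> g} :=
  [ffun l : 'I_n =>
     nth 0 (u :: [seq x m | m <- enum 'I_n.+1 & (m != i) && (m != j)]) l].

(* In the differentials the positions i, j are 0-based, hence the [i.+1] and
   [j.+1] in the signs. *)
Definition dLie n (f : cochain n) : cochain n.+1 := fun x =>
  \sum_(i < n.+1) (-1) ^+ (i.+1 + n) *: br (x i) (f (omit x i)) +
  \sum_(i < n.+1) \sum_(j < n.+1 | (i < j)%N)
    (-1) ^+ (i.+1 + j.+1 + n + 1) *: f (omit2_cons (br (x i) (x j)) x i j).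

Definition dRB n (f : cochain n) : cochain n.+1 := fun x =>
  \sum_(i < n.+1) (-1) ^+ (i.+1 + n) *:
    (br (T (x i)) (f (omit x i)) - T (br (x i) (f (omit x i)))) +
  \sum_(i < n.+1) \sum_(j < n.+1 | (i < j)%N)
    (-1) ^+ (i.+1 + j.+1 + n + 1) *:
      f (omit2_cons (br (T (x i)) (x j) + br (x i) (T (x j))
                     + mu *: br (x i) (x j)) x i j).

Definition shuffles (p n : nat) : {set 'S_n} :=
  [set s : 'S_n | [forall i : 'I_n, forall j : 'I_n,
     (i < j)%N && ((j < p)%N || (p <= i)%N) ==> (s i < s j)%N]].

(* (T x_{s(1)}, ..., T x_{s(p)}, x_{s(p+1)}, ..., x_{s(n)}) *)
Definition shuffle_args n (p : nat) (s : 'S_n) (x : {ffun 'I_n -> g}) :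
  {ffun 'I_n -> g} :=
  [ffun i : 'I_n => if (i < p)%N then T (x (s i)) else x (s i)].

Definition delta n (f : cochain n) : cochain n := fun x =>
  - (\sum_(0 <= l < n.+1) \sum_(s in shuffles l n)
       ((-1) ^+ s * constA_pred (n - l)) *: f (shuffle_args l s x))
  - (\sum_(1 <= l < n.+1) \sum_(s in shuffles l.-1 n)
       ((-1) ^+ s * constB (n - l + 1)) *: T (f (shuffle_args l.-1 s x))).

(* A pair (f, g) in degree n.  Hom(wedge^{-1} g, g) = 0: in degree 0, where
   n.-1 = 0, [is_cochain] forces the second component to vanish. *)
Definition RB_cochain (n : nat) : Type := (cochain n * cochain n.-1)%type.

Definition is_cochain n (c : RB_cochain n) : Prop :=
  [/\ alternating_multilinear c.1, alternating_multilinear c.2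
    & n = 0%N -> c.2 = 0].

Definition dRB_pred n : cochain n.-1 -> cochain n :=
  match n return cochain n.-1 -> cochain n with
  | 0 => fun _ => 0
  | m.+1 => @dRB m
  end.

Definition dRBA n (c : RB_cochain n) : RB_cochain n.+1 :=
  (dLie c.1, - dRB_pred c.2 - delta c.1).

Definition cocycles (n : nat) : set (RB_cochain n) :=
  [set c | is_cochain c /\ dRBA c = 0].

Definition coboundaries (n : nat) : set (RB_cochain n) :=
  match n return set (RB_cochain n) with
  | 0 => [set 0]
  | m.+1 => [set dRBA b | b in [set b : RB_cochain m | is_cochain b]]
  end.

Definition cohomology_class n (z : RB_cochain n) : set (RB_cochain n) :=
  [set c | cocycles c /\ coboundaries (c - z)].

(* H^n, as the set of cohomology classes of n-cocycles *)
Definition cohomology (n : nat) : set (set (RB_cochain n)) :=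
  [set cohomology_class z | z in @cocycles n].

Definition infinitesimal (mut : nat -> g -> g -> g) (Tt : nat -> g -> g) :
  RB_cochain 2 :=
  (fun x : {ffun 'I_2 -> g} => mut 1%N (x ord0) (x ord_max),
   fun x : {ffun 'I_1 -> g} => Tt 1%N (x ord0)).

End Complex.

Arguments cohomology {k g} br T mu lam n.

(* Main.v *)
(* Comparing coefficients of t in the deformed Jacobi and Rota-Baxter
   identities, evaluated on constant series, shows that an infinitesimal is a
   2-cocycle.  Comparing them in the two equivalence equations shows that the
   difference of the infinitesimals is the coboundary of (psi_1, 0). *)
Require Import Defs.
From mathcomp Require Import all_boot all_order all_algebra all_fingroup.
From mathcomp Require Import all_classical.

Set Implicit Arguments.
Unset Strict Implicit.
Unset Printing Implicit Defensive.

Import GRing.Theory.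
Local Open Scope ring_scope.

(** * The Lie and Rota-Baxter differentials in low degree *)

Lemma sum_pairs2 (V : zmodType) (F : 'I_2 -> 'I_2 -> V) :
  \sum_(i < 2) \sum_(j < 2 | (i < j)%N) F i j = F ord0 ord_max.
Proof.
under eq_bigr do rewrite big_mkcond.
rewrite !big_ord_recl !big_ord0 /bump /= !addr0 add0r.
by congr F; apply: val_inj.
Qed.

Lemma sum_pairs3 (V : zmodType) (F : 'I_3 -> 'I_3 -> V) :
  \sum_(i < 3) \sum_(j < 3 | (i < j)%N) F i j =
  F ord0 (inord 1) + F ord0 (inord 2) + F (inord 1) (inord 2).
Proof.
under eq_bigr do rewrite big_mkcond.
rewrite !big_ord_recl !big_ord0 /bump /= !addr0 !add0r.
by congr (F _ _ + F _ _ + F _ _); apply: val_inj; rewrite /= ?inordK.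
Qed.

Lemma dLie1E (k : fieldType) (g : lmodType k) (br : g -> g -> g) (f : g -> g)
    (x : {ffun 'I_2 -> g}) :
  dLie (n := 1) br (fun y => f (y ord0)) x =
  br (x ord0) (f (x ord_max)) - br (x ord_max) (f (x ord0))
  - f (br (x ord0) (x ord_max)).
Proof.
(* Reading [x] through natural numbers makes arguments at ordinals that are equal in value but built
   differently (by [lift], [bump] or [inord]) agree by computation. *)
pose xn i := x (inord i); have X i : x i = xn i by rewrite /xn inord_val.
rewrite /dLie sum_pairs2 !big_ord_recl big_ord0 addr0.
rewrite /bump /= !(exprD, exprS, expr0, mulr1, mulrN1, opprK).
by rewrite !(scale1r, scaleN1r) !ffunE !X.
Qed.

Lemma dRB1E (k : fieldType) (g : lmodType k) (br : g -> g -> g) (T : g -> g)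
    (mu : k) (f : g -> g) (x : {ffun 'I_2 -> g}) :
  dRB (n := 1) br T mu (fun y => f (y ord0)) x =
  (br (T (x ord0)) (f (x ord_max)) - T (br (x ord0) (f (x ord_max))))
  - (br (T (x ord_max)) (f (x ord0)) - T (br (x ord_max) (f (x ord0))))
  - f (br (T (x ord0)) (x ord_max) + br (x ord0) (T (x ord_max))
       + mu *: br (x ord0) (x ord_max)).
Proof.
pose xn i := x (inord i); have X i : x i = xn i by rewrite /xn inord_val.
rewrite /dRB sum_pairs2 !big_ord_recl big_ord0 addr0.
rewrite /bump /= !(exprD, exprS, expr0, mulr1, mulrN1, opprK).
by rewrite !(scale1r, scaleN1r) !ffunE !X.
Qed.

Lemma dLie2E (k : fieldType) (g : lmodType k) (br : g -> g -> g)
    (f : g -> g -> g) (x : {ffun 'I_3 -> g}) (a := x ord0) (b := x (inord 1))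
    (c := x (inord 2)) :
  dLie (n := 2) br (fun y => f (y ord0) (y ord_max)) x =
  - br a (f b c) + br b (f a c) - br c (f a b)
  + (f (br a b) c - f (br a c) b + f (br b c) a).
Proof.
rewrite /a /b /c.
pose xn i := x (inord i); have X i : x i = xn i by rewrite /xn inord_val.
rewrite /dLie sum_pairs3 !big_ord_recl big_ord0 addr0.
rewrite /= ?inordK // /bump /= !(exprD, exprS, expr0, mulr1, mulrN1, opprK).
rewrite !(scale1r, scaleN1r) !ffunE !X.
(* Listing the elements of ['I_3] explicitly lets the filter inside [omit2_cons] compute the one
   index that is left. *)
rewrite !enum_ordSl (size0nil (size_enum_ord 0)) /= -!val_eqE.
rewrite /= ?inordK //= !X /= ?inordK //.
by congr (_ + _); rewrite /bump /= addrA.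
Qed.

(** * Shuffles and the map [delta] in degrees one and two *)

Lemma sum_perm2 (V : zmodType) (P : pred 'S_2) (F : 'S_2 -> V) :
  \sum_(s | P s) F s =
  (if P 1%g then F 1%g else 0) +
  (if P (tperm ord0 ord_max) then F (tperm ord0 ord_max) else 0).
Proof.
rewrite big_mkcond (bigD1 1%g) //= (bigD1 (tperm ord0 ord_max)) /=; last first.
  by apply/eqP => /permP/(_ ord0); rewrite tpermL perm1.
rewrite big1 ?addr0 // => s /andP[s1 st].
have ord2P (i : 'I_2) : (i == ord0) || (i == ord_max) by case: i => [[|[|]]].
have s01 : s ord0 != s ord_max by rewrite (inj_eq perm_inj).
(* The value at [ord0] determines a permutation of two points, as injectivity forces the other
   value. The two cases give the identity and the transposition, both already split off. *)
have [s0 | s0] := eqVneq (s ord0) ord0.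
  case/eqP: s1; apply/permP => i; rewrite perm1.
  have [-> // | i0] := eqVneq i ord0.
  have /eqP -> : i == ord_max by have := ord2P i; rewrite (negPf i0).
  have := ord2P (s ord_max); rewrite -{1}s0 eq_sym (negPf s01) /=.
  by move/eqP.
case/eqP: st; apply/permP => i.
have /eqP s0E : s ord0 == ord_max by have := ord2P (s ord0); rewrite (negPf s0).
have [-> | i0] := eqVneq i ord0; first by rewrite tpermL s0E.
have /eqP -> : i == ord_max by have := ord2P i; rewrite (negPf i0).
rewrite tpermR.
have := ord2P (s ord_max); rewrite -[X in _ || (_ == X)]s0E.
by rewrite [X in _ || X]eq_sym (negPf s01) orbF => /eqP.
Qed.

Lemma shuffles1 p n : 1%g \in shuffles p n.
Proof.
rewrite inE; apply/forallP => i; apply/forallP => j; rewrite !perm1.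
by apply/implyP => /andP[].
Qed.

(** Only for [p = 1] do the two positions lie in different blocks; otherwise they share a block, on
    which a shuffle must be increasing. *)
Lemma shuffles_tperm2 p :
  (tperm ord0 ord_max \in shuffles p 2) = (p == 1%N).
Proof.
rewrite inE; apply/forallP/eqP => [/(_ ord0)/forallP/(_ ord_max) | -> i].
  by rewrite tpermL tpermR /=; case: p => [|[|p]].
by apply/forallP => j; case: i j => [[|[|]] // ?] [[|[|]] // ?].
Qed.

(** The coefficients that occur are A_0 = 0, A_{-1} = -1 and B_1 = 1. *)
Lemma delta1E (k : fieldType) (g : lmodType k) (T : g -> g) (mu lam : k)
    (f : g -> g) (x : {ffun 'I_1 -> g}) :
  delta T mu lam (n := 1) (fun y => f (y ord0)) x =
  f (T (x ord0)) - T (f (x ord0)).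
Proof.
have S1 (P : pred 'S_1) (F : 'S_1 -> g) : P 1%g -> \sum_(s | P s) F s = F 1%g.
  move=> P1; rewrite (eq_bigl (pred1 1%g)) ?big_pred1_eq // => s /=.
  have /eqP -> // : s == 1%g; last by rewrite P1 eqxx.
  by apply/eqP/permP => i; rewrite [LHS]ord1 [RHS]ord1.
rewrite /delta -[index_iota 0 2]/[:: 0; 1]%N -[index_iota 1 2]/[:: 1]%N.
rewrite !big_cons !big_nil !S1 ?shuffles1 // !(subSS, subn0) !addn1.
rewrite odd_perm1 expr0 /= !mul1r mulr0 scale0r scale1r scaleN1r.
by rewrite !ffunE /= !perm1 add0r !addr0 opprK.
Qed.

Lemma linear_f0 (k : fieldType) (g h : lmodType k) (f : g -> h) :
  linear f -> f 0 = 0.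
Proof.
by move=> /GRing.zmod_morphism_linear fB; rewrite -(subrr 0) fB !subrr.
Qed.

Lemma linear_fN (k : fieldType) (g h : lmodType k) (f : g -> h) :
  linear f -> {morph f : u / - u}.
Proof.
by move=> flin u; rewrite -!scaleN1r (GRing.scalable_linear flin).
Qed.

(** The coefficients are A_1 = lam, A_0 = 0, A_{-1} = -1, B_2 = mu and B_1 = 1. The only place where
    the transposition counts is the B_1 term; there skew-symmetry turns - f (T b) a into f a (T b).
    The result is the part of the Rota-Baxter identity that is linear in the bracket. *)
Lemma delta2E (k : fieldType) (g : lmodType k) (T : g -> g) (mu lam : k)
    (f : g -> g -> g) (x : {ffun 'I_2 -> g}) (a := x ord0) (b := x ord_max) :
  (forall u v, f v u = - f u v) -> linear T ->
  delta T mu lam (n := 2) (fun y => f (y ord0) (y ord_max)) x =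
  f (T a) (T b) - T (f (T a) b + f a (T b) + mu *: f a b) - lam *: f a b.
Proof.
move=> fN Tlin; have [_ TD] := GRing.semilinear_linear Tlin.
have TZ c u : T (c *: u) = c *: T u by apply: GRing.scalable_linear.
have TN := linear_fN Tlin.
rewrite /delta -[index_iota 0 3]/[:: 0; 1; 2]%N -[index_iota 1 3]/[:: 1; 2]%N.
rewrite !big_cons !big_nil !(subSS, subn0) !addn1 !sum_perm2 !shuffles1.
rewrite !shuffles_tperm2 /= odd_perm1 odd_tperm /= expr0 expr1.
rewrite !ffunE /= !perm1 !tpermL !tpermR -/a -/b.
rewrite !mul1r !mulr0 !scale0r !mulr1 subr0 !addr0 !add0r !scale1r !scaleN1r.
rewrite (fN a (T b)) !TD TZ TN opprK.
rewrite opprD opprK (addrC (- _) (f _ _)) [RHS]addrAC.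
by congr (_ - _ - _); rewrite addrC.
Qed.

(** * Linear and alternating bilinear maps as cochains *)

Lemma linear_alternating (k : fieldType) (g : lmodType k) (f : g -> g) :
  linear f -> alternating_multilinear (n := 1) (fun x => f (x ord0)).
Proof.
move=> flin; split=> [x i a u v | x i j]; last by rewrite !ord1.
by rewrite !ffunE !ord1 flin.
Qed.

Lemma alt_bilinear_alternating (k : fieldType) (g : lmodType k)
    (f : g -> g -> g) :
  alt_bilinear f ->
  alternating_multilinear (n := 2) (fun x => f (x ord0) (x ord_max)).
Proof.
case=> flinr flinl falt; split=> [x i a u v | x i j].
  rewrite !ffunE; case: i => [[|[|]] // ?] /=; [exact: flinl | exact: flinr].
case: i j => [[|[|]] // ?] [[|[|]] // ?] // _ eqx.
  rewrite (_ : x ord0 = x ord_max) //.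
  by apply: etrans (etrans _ eqx) _; congr (x _); apply: val_inj.
rewrite (_ : x ord0 = x ord_max) //.
by apply: etrans (etrans _ (esym eqx)) _; congr (x _); apply: val_inj.
Qed.

(** * Coefficients of order zero and one *)

Definition fps_const (V : zmodType) (v : V) : fps V :=
  fun n => if n == 0%N then v else 0.

Lemma fps_ext1_coef0 (k : fieldType) (g : lmodType k) (F : nat -> g -> g)
    (a : fps g) :
  fps_ext1 F a 0%N = F 0%N (a 0%N).
Proof. by rewrite /fps_ext1 big_ord1. Qed.

Lemma fps_ext1_coef1 (k : fieldType) (g : lmodType k) (F : nat -> g -> g)
    (a : fps g) :
  fps_ext1 F a 1%N = F 0%N (a 1%N) + F 1%N (a 0%N).
Proof. by rewrite /fps_ext1 !big_ord_recl big_ord0 addr0. Qed.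

Lemma fps_ext2_coef0 (k : fieldType) (g : lmodType k) (m : nat -> g -> g -> g)
    (a b : fps g) :
  fps_ext2 m a b 0%N = m 0%N (a 0%N) (b 0%N).
Proof. by rewrite /fps_ext2 !big_ord1. Qed.

Lemma fps_ext2_coef1 (k : fieldType) (g : lmodType k) (m : nat -> g -> g -> g)
    (a b : fps g) :
  fps_ext2 m a b 1%N =
  m 0%N (a 0%N) (b 1%N) + m 0%N (a 1%N) (b 0%N) + m 1%N (a 0%N) (b 0%N).
Proof.
by rewrite /fps_ext2 !big_ord_recl !big_ord0 !addr0.
Qed.

Lemma fps_scaleC_coef0 (k : fieldType) (g : lmodType k) (c : k) (v : fps g) :
  (fpsC c *: v) 0%N = c *: v 0%N.
Proof. by rewrite /GRing.scale /= /fps_scale big_ord1. Qed.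

Lemma fps_scaleC_coef1 (k : fieldType) (g : lmodType k) (c : k) (v : fps g) :
  (fpsC c *: v) 1%N = c *: v 1%N.
Proof.
by rewrite /GRing.scale /= /fps_scale !big_ord_recl big_ord0 scale0r !addr0.
Qed.

(** Constant series have no coefficient of order one, so by bilinearity of [m 0] only the products
    with exactly one factor [m 1] survive. *)
Lemma jacobi_coef1 (k : fieldType) (g : lmodType k) (m : nat -> g -> g -> g) :
  alt_bilinear (m 0%N) -> jacobi (fps_ext2 m) -> forall x y z,
  m 0%N x (m 1%N y z) + m 1%N x (m 0%N y z) +
  (m 0%N y (m 1%N z x) + m 1%N y (m 0%N z x)) +
  (m 0%N z (m 1%N x y) + m 1%N z (m 0%N x y)) = 0.
Proof.
case=> mlinr mlinl _ jac x y z.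
have m0r u : m 0%N u 0 = 0 by apply: linear_f0.
have m0l u : m 0%N 0 u = 0 by apply: (linear_f0 (mlinl u)).
have := congr1 (@^~ 1%N) (jac (fps_const x) (fps_const y) (fps_const z)).
rewrite !fps_addE !(fps_ext2_coef1, fps_ext2_coef0) /fps_const /=.
by rewrite !(m0r, m0l, addr0, add0r).
Qed.

(** The weights are constant series, so each surviving term differentiates exactly one occurrence of
    the bracket or of the operator. *)
Lemma ext_rota_baxter_coef1 (k : fieldType) (g : lmodType k)
    (m : nat -> g -> g -> g) (F : nat -> g -> g) (mu lam : k) :
  alt_bilinear (m 0%N) -> linear (F 0%N) ->
  ext_rota_baxter (R := fps k) (V := fps g)
    (fps_ext2 m) (fps_ext1 F) (fpsC mu) (fpsC lam) ->
  let br := m 0%N in let T := F 0%N in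
  forall a b,
  br (T a) (F 1%N b) + br (F 1%N a) (T b) + m 1%N (T a) (T b) =
  T (br (F 1%N a) b + m 1%N (T a) b + (br a (F 1%N b) + m 1%N a (T b))
     + mu *: m 1%N a b)
  + F 1%N (br (T a) b + br a (T b) + mu *: br a b) + lam *: m 1%N a b.
Proof.
case=> mlinr mlinl _ Flin rb /= a b.
have m0r u : m 0%N u 0 = 0 by apply: linear_f0.
have m0l u : m 0%N 0 u = 0 by apply: (linear_f0 (mlinl u)).
have F0 : F 0%N 0 = 0 by apply: linear_f0.
have := congr1 (@^~ 1%N) (rb (fps_const a) (fps_const b)).
rewrite !(fps_addE, fps_scaleC_coef1, fps_scaleC_coef0, fps_ext2_coef1,
  fps_ext2_coef0, fps_ext1_coef1, fps_ext1_coef0) /fps_const /=.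
by rewrite !(m0r, m0l, F0, addr0, add0r).
Qed.

(** * Infinitesimals are 2-cocycles *)

Lemma alt_bilinearN (k : fieldType) (g : lmodType k) (f : g -> g -> g) :
  alt_bilinear f -> forall u v, f v u = - f u v.
Proof.
case=> flinr flinl falt u v.
have [_ fDr] := GRing.semilinear_linear (flinr (u + v)).
have fDl w := (GRing.semilinear_linear (flinl w)).2.
have /= := falt (u + v); rewrite fDr !fDl !falt add0r addr0 => /eqP.
by rewrite addr_eq0 => /eqP.
Qed.

Lemma infinitesimal_is_cochain (k : fieldType) (g : lmodType k)
    (m : nat -> g -> g -> g) (F : nat -> g -> g) :
  alt_bilinear (m 1%N) -> linear (F 1%N) -> is_cochain (infinitesimal m F).
Proof.
by move=> m1 F1; split=> //=; [exact: alt_bilinear_alternating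
                              | exact: linear_alternating].
Qed.

Lemma infinitesimal_cocycle (k : fieldType) (g : lmodType k) (mu lam : k)
    (br : g -> g -> g) (T : g -> g) (m : nat -> g -> g -> g)
    (F : nat -> g -> g) :
  formal_deformation br T mu lam m F ->
  cocycles br T mu lam (infinitesimal m F).
Proof.
case=> malt Flin <- <- [_ jac _ rb].
have mN i := alt_bilinearN (malt i).
have [m0linr _ _] := malt 0%N.
have m0Nr u v : m 0%N u (- v) = - m 0%N u v by apply: linear_fN.
have [_ m1linl _] := malt 1%N.
have m1Nl u v : m 1%N (- u) v = - m 1%N u v by apply: (linear_fN (m1linl v)).
have [_ FD] := GRing.semilinear_linear (Flin 0%N).
have FN := linear_fN (Flin 0%N).
split; first exact: infinitesimal_is_cochain.
congr pair; apply/funext => x.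
  rewrite (dLie2E (m 0%N) (m 1%N)).
  set a := x _; set b := x _; set c := x _.
  have := jacobi_coef1 (malt 0%N) jac a b c.
  rewrite (mN 1%N a c) m0Nr (mN 1%N (m 0%N b c) a) (mN 1%N (m 0%N c a) b).
  rewrite (mN 0%N a c) m1Nl opprK (mN 1%N (m 0%N a b) c) => J.
  (* Once skew-symmetry has fixed the order of the arguments, the six terms of [J] are those of
     [dLie] with opposite signs. *)
  apply: oppr_inj; rewrite oppr0 -J !opprD !opprK.
  by rewrite +%R.[AC (3*3) ((1*6)*(2*5)*(3*4))].
rewrite -[LHS]/(- dRB _ _ _ (fun y => F 1%N (y ord0)) x -
  delta _ _ _ (fun y => m 1%N (y ord0) (y ord_max)) x).
rewrite -[RHS]/(0 : g) (dRB1E (m 0%N) (F 0%N) mu (F 1%N)) delta2E //.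
set a := x _; set b := x _.
have := ext_rota_baxter_coef1 (malt 0%N) (Flin 0%N) rb a b => /=.
rewrite (mN _ (F 1%N a) (F 0%N b)) (mN _ (F 1%N a) b).
rewrite !FD !FN => /eqP; rewrite -subr_eq0 => /eqP RB.
(* Left side minus right side of the first-order Rota-Baxter identity is [dRB] of [F 1] plus [delta]
   of [m 1], the negative of the second component. *)
apply: oppr_inj; rewrite oppr0 -RB !opprD !opprK.
by rewrite +%R.[AC ((2*2*1)*(1*3*1)) ((1*3*6)*((4*7*(2*8)*9)*5*10))].
Qed.

(** * Coboundaries and equivalent deformations *)

Lemma dRB0 (k : fieldType) (g : lmodType k) (br : g -> g -> g) (T : g -> g)
    (mu : k) n :
  (forall x, linear (br x)) -> linear T -> dRB br T mu (0 : cochain g n) = 0.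
Proof.
move=> brlin Tlin; apply/funext => x; rewrite /dRB.
rewrite !big1 ?addr0 // => i _; last first.
  by rewrite !(linear_f0 (brlin _)) (linear_f0 Tlin) subrr scaler0.
by rewrite big1 // => j _; rewrite scaler0.
Qed.

(** This pair is the differential of (f, 0). It serves twice: with f = psi_1 to compare the two
    infinitesimals, and with f = 0 to see that 0 is a coboundary. *)
Lemma coboundary_linear (k : fieldType) (g : lmodType k) (mu lam : k)
    (br : g -> g -> g) (T f : g -> g) :
  (forall x, linear (br x)) -> linear T -> linear f ->
  coboundaries br T mu lam (n := 2)
    (fun x : {ffun 'I_2 -> g} =>
       br (x ord0) (f (x ord_max)) - br (x ord_max) (f (x ord0))
       - f (br (x ord0) (x ord_max)),
     fun x : {ffun 'I_1 -> g} => T (f (x ord0)) - f (T (x ord0))).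
Proof.
move=> brlin Tlin flin.
exists (fun x : {ffun 'I_1 -> g} => f (x ord0), 0) => /=.
  split=> //; first exact: linear_alternating.
  (* The second component has degree 0, so both conditions range over the empty type ['I_0]. *)
  split=> [x [] // | x [] //].
rewrite /dRBA /= dRB0 // oppr0 sub0r; congr pair; apply/funext => x.
  exact: dLie1E.
by rewrite -[LHS]/(- delta _ _ _ _ x) delta1E opprB.
Qed.

(** Since [psi 0] is the identity, [m' 1] and [F' 1] appear bare in the coefficient of order one.
    Solving for [m' 1 - m 1] and [F' 1 - F 1] gives the components of the differential of (psi_1,
    0), up to skew-symmetry of [m 0]. *)
Lemma equivalent_coef1 (k : fieldType) (g : lmodType k)
    (m m' : nat -> g -> g -> g) (F F' psi : nat -> g -> g) :
  alt_bilinear (m 0%N) -> m' 0%N = m 0%N ->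
  linear (F 0%N) -> F' 0%N = F 0%N -> psi 0%N = id ->
  (forall a b : fps g, fps_ext1 psi (fps_ext2 m' a b) =
     fps_ext2 m (fps_ext1 psi a) (fps_ext1 psi b)) ->
  (forall a : fps g,
     fps_ext1 psi (fps_ext1 F' a) = fps_ext1 F (fps_ext1 psi a)) ->
  (forall a b, m' 1%N a b + psi 1%N (m 0%N a b) =
     m 0%N a (psi 1%N b) + m 0%N (psi 1%N a) b + m 1%N a b) /\
  (forall a, F' 1%N a + psi 1%N (F 0%N a) = F 0%N (psi 1%N a) + F 1%N a).
Proof.
case=> mlinr mlinl _ m'0 Flin F'0 psi0 psim psiF.
have m0r u : m 0%N u 0 = 0 by apply: linear_f0.
have m0l u : m 0%N 0 u = 0 by apply: (linear_f0 (mlinl u)).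
have F0 : F 0%N 0 = 0 by apply: linear_f0.
split=> [a b | a].
  have := congr1 (@^~ 1%N) (psim (fps_const a) (fps_const b)).
  rewrite !(fps_ext2_coef1, fps_ext2_coef0, fps_ext1_coef1, fps_ext1_coef0).
  by rewrite m'0 psi0 /fps_const /= m0r m0l !add0r.
have := congr1 (@^~ 1%N) (psiF (fps_const a)).
rewrite !(fps_ext1_coef1, fps_ext1_coef0).
by rewrite F'0 psi0 /fps_const /= F0 !add0r.
Qed.

Unset Implicit Arguments.

Theorem theorem7p5 (k : fieldType) (g : lmodType k)
  (mu lam : k) (br : g -> g -> g) (T : g -> g)
  (mut mut' : nat -> g -> g -> g) (Tt Tt' : nat -> g -> g) :
  [pchar k] =i pred0 ->
  (exists r : k, r ^+ 2 = mu ^+ 2 - 4 * lam) ->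
  ext_RB_Lie_algebra br T mu lam ->
  formal_deformation br T mu lam mut Tt ->
  formal_deformation br T mu lam mut' Tt' ->
  equivalent_deformations mut Tt mut' Tt' ->
  exists2 c : set (RB_cochain g 2),
    cohomology br T mu lam 2 c &
    c (infinitesimal mut Tt) /\ c (infinitesimal mut' Tt').
Proof.
move=> _ _ [bralt _ Tlin _] def def' [psi [psilin psi0 psim psiT]].
have [[brlin _ _] brN] := (bralt, alt_bilinearN bralt).
have [z z'] := (infinitesimal_cocycle def, infinitesimal_cocycle def').
exists (cohomology_class br T mu lam (infinitesimal mut Tt)).
  by exists (infinitesimal mut Tt).
have [_ _ m0 T0 _] := def; have [_ _ m'0 T'0 _] := def'.
rewrite -m0 in bralt; rewrite -T0 in Tlin.
have [psim1 psiT1] := equivalent_coef1 bralt (etrans m'0 (esym m0)) Tlin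
  (etrans T'0 (esym T0)) psi0 psim psiT.
rewrite m0 in psim1; rewrite T0 in psiT1 Tlin.
split; split=> //.
  (* The representative lies in its own class because its difference with itself is the differential
     of (0, 0). *)
  have lin0 : linear (fun _ : g => 0 : g).
    by move=> c u v; rewrite scaler0 addr0.
  have := coboundary_linear mu lam brlin Tlin lin0; congr coboundaries.
  rewrite subrr; congr pair; apply/funext => x.
    by rewrite !(linear_f0 (brlin _)) !subr0.
  by rewrite (linear_f0 Tlin) subr0.
(* For the other infinitesimal the witness is psi_1; [brN] below moves it to the second argument of
   the bracket, as in [dLie]. *)
have := coboundary_linear mu lam brlin Tlin (psilin 1%N); congr coboundaries.
congr pair; apply/funext => x; apply/esym.
  rewrite -[LHS]/(mut' 1%N _ _ - mut 1%N _ _).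
  apply/eqP; rewrite subr_eq addrAC eq_sym subr_eq eq_sym psim1.
  by rewrite (brN (psi 1%N (x ord0))) opprK.
rewrite -[LHS]/(Tt' 1%N _ - Tt 1%N _).
by apply/eqP; rewrite subr_eq addrAC eq_sym subr_eq eq_sym psiT1.
Qed.
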